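(* Let $1\le q<\sqrt3$ and let $T$ be a bounded operator on a complex Banach space with $\sup_{n\ge1}\|I-T^n\|\le q$. Then $T$ is a Ritt operator and $$C_{\mathrm R}(T)\le\frac{2\sqrt3\,M(T)}{\sqrt3-q}\le\frac{6+2\sqrt3}{\sqrt3-q}.$$ For $0\le r<1$, put $a_r=r\exp\bigl(i\arccos(-r/2)\bigr)$. Then $$q_r:=\sup_{n\ge1}|1-a_r^n|=\sqrt{1+2r^2},\qquad C_{\mathrm R}(a_r)=\frac{2q_r}{1-r^2}=\frac{4q_r}{3-q_r^2},$$ where $a_r$ is regarded as a scalar operator on $\mathbb C$. Consequently, $$\frac{4q}{3-q^2}\le\Phi_*(q)\le\frac{6+2\sqrt3}{\sqrt3-q}\qquad(1\le q<\sqrt3).$$ The threshold $\sqrt3$ is optimal: $T=e^{2\pi i/3}I$ satisfies $\sup_{n\ge1}\|I-T^n\|=\sqrt3$ and is not Ritt. For every $q\in[\sqrt3,2)$, the Ritt constants of the Ritt operators $T$ satisfying $\sup_{n\ge1}\|I-T^n\|\le q$ are unbounded, even for scalar operators with spectrum in $\mathbb D$.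
   Context: $\mathbb D$ is the open unit disc. A bounded operator $T$ on a complex Banach space is a Ritt operator if $\sigma(T)\subset\overline{\mathbb D}$ and its Ritt constant $C_{\mathrm R}(T):=\sup_{|\lambda|>1}|\lambda-1|\,\|(\lambda-T)^{-1}\|$ is finite. $M(T):=\sup_{n\ge0}\|T^n\|$. For $1\le q<\sqrt3$, $\Phi_*(q):=\sup\{C_{\mathrm R}(S): Y\text{ a complex Banach space},\ S\in\mathcal B(Y),\ \sup_{n\ge1}\|I-S^n\|\le q\}$. *)

(* Defs.v *)
From HB Require Import structures.
From mathcomp Require Import all_boot all_order all_algebra complex.
From mathcomp Require Import all_classical all_reals all_analysis.

Set Implicit Arguments.
Unset Strict Implicit.
Unset Printing Implicit Defensive.

Import Order.TTheory GRing.Theory Num.Theory.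
Import numFieldNormedType.Exports.

Local Open Scope classical_set_scope.
Local Open Scope ring_scope.
Local Open Scope complex_scope.

Section Complex.
Variable R : realType.

(* The library norm on R[i], and on normed modules over it, takes values in
   R[i]; its values are nonnegative reals, so [Re] loses nothing. *)
Definition rnorm (X : normedModType R[i]) (x : X) : R := complex.Re `|x|.

Definition cmod (z : R[i]) : R := complex.Re `|z|.

(* exp (i t) *)
Definition cis (t : R) : R[i] := cos t +i* sin t.

Definition open_unit_disc : set R[i] := [set z | cmod z < 1].
Definition closed_unit_disc : set R[i] := [set z | cmod z <= 1].

End Complex.

Arguments open_unit_disc {R}.
Arguments closed_unit_disc {R}.

Section Operators.
Variables (R : realType) (X : normedModType R[i]).
Local Open Scope ereal_scope.

(* Defined for arbitrary maps so that it applies directly to [iter n T] and to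
   [fun x => x - iter n T x]; equal to +oo for an unbounded linear map. *)
Definition opnorm (f : X -> X) : \bar R :=
  ereal_sup [set (rnorm (f x))%:E | x in [set x | (rnorm x <= 1)%R]].

Definition bounded_op (T : {linear X -> X}) : Prop := opnorm T < +oo.

Definition scalar_op (a : R[i]) : {linear X -> X} := ( *:%R a).

Definition is_resolvent (T : {linear X -> X}) (lam : R[i])
    (S : {linear X -> X}) : Prop :=
  [/\ bounded_op S,
      forall x, S (lam *: x - T x)%R = x
    & forall x, (lam *: S x - T (S x))%R = x].

Definition spectrum (T : {linear X -> X}) : set R[i] :=
  [set lam | ~ exists S, is_resolvent T lam S].

(* ||(lam - T)^-1||: the set below has at most one element, and the infimum of
   the empty set is +oo, so the value is +oo exactly when lam is in the
   spectrum of T. *)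
Definition resolvent_norm (T : {linear X -> X}) (lam : R[i]) : \bar R :=
  ereal_inf [set opnorm S | S in is_resolvent T lam].

Definition ritt_const (T : {linear X -> X}) : \bar R :=
  ereal_sup [set (cmod (lam - 1))%:E * resolvent_norm T lam
            | lam in [set lam : R[i] | (1 < cmod lam)%R]].

Definition ritt (T : {linear X -> X}) : Prop :=
  [/\ bounded_op T, spectrum T `<=` closed_unit_disc & ritt_const T < +oo].

Definition power_bound (T : {linear X -> X}) : \bar R :=
  ereal_sup [set opnorm (iter n T) | n in [set: nat]].

(* sup_{n >= 1} ||I - T^n|| *)
Definition power_dev (T : {linear X -> X}) : \bar R :=
  ereal_sup [set opnorm (fun x => x - iter n T x)%R
            | n in [set n | (1 <= n)%N]].

End Operators.

Definition Phi_star (R : realType) (q : R) : \bar R :=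
  ereal_sup [set c : \bar R |
    exists (Y : completeNormedModType R[i]) (S : {linear Y -> Y}),
      [/\ bounded_op S, (power_dev S <= q%:E)%E & c = ritt_const S]].

(* Main.v *)
Require Import Defs.
From HB Require Import structures.
From mathcomp Require Import all_boot all_order all_algebra complex.
From mathcomp Require Import all_classical all_reals all_analysis.
From mathcomp Require Import ring lra zify.

(** The upper bound rests on one fact about complex numbers
    ([exists_far_power]): every [lam] with [|lam| > 1] has a power [lam ^ n]
    at distance at least [sqrt 3] from [1], reached so early that
    [|lam - 1| * (1 + |lam| + ... + |lam|^(n-1)) <= 2 |lam ^ n - 1|].  Up
    to conjugation the argument of [lam] lies in [[0, pi]]; unless it is [0],
    in which case any large [n] will do, choose [n] so that [n] times the
    argument is the first multiple of it in [[2 pi / 3, 4 pi / 3]].  This is a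
    sector whose points of modulus at least [1] are at distance at least
    [sqrt 3] from [1].

    Given such an [n], put [y = (lam - T) x].  The telescoping identity
    [lam^n x - T^n x = sum_k lam^(n-1-k) T^k y] writes [(lam^n - 1) x] as
    [sum_k lam^(n-1-k) T^k y - (x - T^n x)].  The last difference is at most
    [q |x|], so [(|lam^n - 1| - q) |x| <= M(T) |y| sum_k |lam|^k], and the
    choice of [n] turns this into
    [|lam - 1| |x| <= 2 sqrt 3 / (sqrt 3 - q) * M(T) * |y|]
    ([resolvent_lower_bound]).  The resolvent itself exists outside the closed
    disc by the Neumann series, since [T] is power bounded
    ([resolvent_exists]), and [M(T) <= 1 + q < 1 + sqrt 3] gives the second
    constant.

    For a scalar [a] in the disc, [(lam - 1) / (lam - a)] is an affine function
    of the Moebius transform [w = (1 - a^* lam) / (lam - a)], which maps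
    [|lam| > 1] into the unit disc; maximising over [|w| < 1] gives the exact
    Ritt constant [2 |1 - a| / (1 - |a|^2)] ([ritt_const_scalar_disc]).  The
    number [a_r] is a root of [X^2 + s X + s] with [s = r^2], and the
    resulting three-step recursion shows that [|1 - a^n|^2 <= 1 + 2 s]
    ([sup_dev_quadratic]).  The case [s = 1] of the same computation is the
    cube root of unity, and letting [r] tend to [1] makes the Ritt constants
    blow up while the deviations stay below [sqrt 3]. *)

Import Order.TTheory GRing.Theory Num.Theory.
Import numFieldNormedType.Exports.

Local Open Scope classical_set_scope.
Local Open Scope ring_scope.
Local Open Scope complex_scope.

(** * Trigonometric estimates *)

Section Trigonometry.
Context {R : realType}.
Implicit Types x t : R.

Lemma le_of_derive_ge0 (f df : R -> R) (x : R) : 0 <= x ->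
  (forall t, is_derive t 1 f (df t)) ->
  (forall t, 0 <= t <= x -> 0 <= df t) -> f 0 <= f x.
Proof.
move=> x0 fd df0.
have [] := @MVT_segment R f df 0 x x0.
- apply: continuous_subspaceT => y.
  by apply: differentiable_continuous; apply/derivable1_diffP; case: (fd y).
- move=> c; rewrite in_itv /= => /df0 c0 fE.
  by rewrite -subr_ge0 fE subr0 mulr_ge0.
Qed.

Lemma sin_le x : 0 <= x -> sin x <= x.
Proof.
move=> x0; rewrite -subr_ge0.
have := @le_of_derive_ge0 (fun t => t - sin t) (fun t => 1 - cos t) x x0.
rewrite sin0 subr0; apply => t _.
by rewrite subr_ge0 cos_le1.
Qed.

Lemma one_sub_cos_le x : 0 <= x -> 1 - cos x <= x ^+ 2 / 2.
Proof.
move=> x0; rewrite -subr_ge0.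
have := @le_of_derive_ge0 (fun t => t ^+ 2 / 2 - (1 - cos t))
  (fun t => t - sin t) x x0.
rewrite cos0 subrr subr0 expr0n mul0r; apply => [t|t /andP[t0 _]].
  by apply: is_derive_eq; rewrite !scaler0 add0r /GRing.scale /=; field.
by rewrite subr_ge0 sin_le.
Qed.

Lemma mulr_cos_le_sin x : 0 <= x <= pi -> x * cos x <= sin x.
Proof.
move=> /andP[x0 xpi]; rewrite -subr_ge0.
have := @le_of_derive_ge0 (fun t => sin t - t * cos t)
  (fun t => t * sin t) x x0.
rewrite sin0 mul0r subr0; apply => [t|t /andP[t0 tx]].
  by apply: is_derive_eq; rewrite /GRing.scale /=; ring.
by rewrite mulr_ge0 // sin_ge0_pi // t0 (le_trans tx).
Qed.

Lemma cos3x x : cos (3 * x) = 4 * cos x ^+ 3 - 3 * cos x.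
Proof.
have -> : 3 * x = x + x + x by ring.
rewrite !(cosD, sinD).
have := cos2Dsin2 x => /(canRL (addKr _)) s2.
transitivity (cos x ^+ 3 - 3 * cos x * sin x ^+ 2); first ring.
by rewrite s2; ring.
Qed.

Lemma cos_two_thirds_pi : cos (2 * pi / 3 : R) = - (1 / 2).
Proof.
have pi0 := pi_gt0 R.
have : cos (3 * (2 * pi / 3 : R)) = 1.
  have -> : 3 * (2 * pi / 3 : R) = pi + pi by field.
  by rewrite cosD cospi sinpi; ring.
rewrite cos3x => h.
have c1 : cos (2 * pi / 3 : R) < 1.
  by rewrite -[ltRHS]cos0 ltr_cos ?in_itv /=; lra.
move: h c1; set c := cos _ => h c1.
have {h} : (c - 1) * (2 * c + 1) ^+ 2 = 0.
  have -> : (c - 1) * (2 * c + 1) ^+ 2 = 4 * c ^+ 3 - 3 * c - 1 by ring.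
  by rewrite h subrr.
move/eqP; rewrite mulf_eq0 sqrf_eq0 => /orP[] /eqP; lra.
Qed.

(** Evaluating [x cos x <= sin x] at [pi / 6], where [cos = sqrt 3 / 2] and
    [sin = 1 / 2]. *)
Lemma pi_le : (pi : R) <= 2 * Num.sqrt 3.
Proof.
have pi0 := pi_gt0 R.
set u : R := pi / 6.
have cu : 0 < cos u by apply: cos_gt0_pihalf; rewrite /u; lra.
have su : 0 < sin u by apply: sin_gt0_pi; rewrite /u; lra.
have : cos (3 * u) = 0.
  by rewrite -(cos_pihalf R); congr cos; rewrite /u; field.
rewrite cos3x => h.
have c2 : cos u ^+ 2 = 3 / 4.
  have : cos u * (4 * cos u ^+ 2 - 3) = 0 by rewrite -h; ring.
  move/eqP; rewrite mulf_eq0 => /orP[] /eqP; lra.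
have s2 : sin u ^+ 2 = 1 / 4 by have := cos2Dsin2 u; lra.
have h1 : u * cos u <= sin u by apply: mulr_cos_le_sin; rewrite /u; lra.
have h2 : (u * cos u) ^+ 2 <= sin u ^+ 2.
  by rewrite ler_sqr ?nnegrE // ?mulr_ge0 // ?(ltW cu) ?(ltW su) // /u; lra.
rewrite exprMn c2 s2 in h2.
have s3 : Num.sqrt (3 : R) ^+ 2 = 3 by rewrite sqr_sqrtr.
have s30 : 0 <= Num.sqrt (3 : R) by rewrite sqrtr_ge0.
rewrite -ler_sqr ?nnegrE ?mulr_ge0 ?pi_ge0 // exprMn s3.
have -> : (pi : R) ^+ 2 = 36 * u ^+ 2 by rewrite /u; field.
move: h2; move: (u ^+ 2) => v h2; lra.
Qed.

Lemma cos_le_mhalf x : 2 * pi / 3 <= x <= 4 * pi / 3 -> cos x <= - (1 / 2).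
Proof.
have pi0 := pi_gt0 R; move=> /andP[x1 x2].
wlog xpi : x x1 x2 / x <= pi.
  move=> hw; have [|xpi] := leP x pi; first exact: hw.
  have -> : cos x = cos (pi + pi - x).
    by rewrite cosB cosD sinD cospi sinpi; ring.
  by apply: hw; lra.
by rewrite -cos_two_thirds_pi leNgt ltr_cos ?in_itv /= -?leNgt //; lra.
Qed.

End Trigonometry.

(** * Modulus and polar form of complex numbers *)

Section ComplexModulus.
Context {R : realType}.
Implicit Types (z w : R[i]) (r t : R).

Lemma real_cmod z : (cmod z)%:C = `|z|.
Proof. by rewrite /cmod RRe_real // normr_real. Qed.

Lemma cmod_ge0 z : 0 <= cmod z.
Proof. by rewrite -ler0c real_cmod. Qed.

Lemma cmodM z w : cmod (z * w) = cmod z * cmod w.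
Proof. exact: Normc.normcM. Qed.

Lemma cmodV z : cmod z^-1 = (cmod z)^-1.
Proof. exact: Normc.normcV. Qed.

Lemma cmodN z : cmod (- z) = cmod z.
Proof. by rewrite /cmod normrN. Qed.

Lemma cmod_distC z w : cmod (z - w) = cmod (w - z).
Proof. by rewrite /cmod distrC. Qed.

Lemma cmod1 : cmod (1 : R[i]) = 1.
Proof. exact: Normc.normc1. Qed.

Lemma cmodX z n : cmod (z ^+ n) = cmod z ^+ n.
Proof. by elim: n => [|n IH]; rewrite ?expr0 ?cmod1// !exprS cmodM IH. Qed.

Lemma cmodD z w : cmod (z + w) <= cmod z + cmod w.
Proof. by rewrite -lecR rmorphD /= !real_cmod ler_normD. Qed.

Lemma cmod_eq0 z : (cmod z == 0) = (z == 0).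
Proof. by rewrite -(inj_eq (@complexI R)) real_cmod normr_eq0. Qed.

Lemma cmod_real r : cmod r%:C = `|r|.
Proof. by rewrite /cmod normc_def /= expr0n addr0 sqrtr_sqr. Qed.

Lemma sqr_cmod z : cmod z ^+ 2 = complex.Re z ^+ 2 + complex.Im z ^+ 2.
Proof.
by rewrite /cmod normc_def /= sqr_sqrtr // addr_ge0 // sqr_ge0.
Qed.

Lemma sqr_cmod_sub1 z :
  cmod (z - 1) ^+ 2 = cmod z ^+ 2 + 1 - 2 * complex.Re z.
Proof. by rewrite !sqr_cmod; case: z => a b /=; ring. Qed.

Lemma ler_cmod_sub z w : cmod z - cmod w <= cmod (z - w).
Proof. by have := cmodD (z - w) w; rewrite subrK lerBlDr. Qed.

Lemma cmod_cis t : cmod (cis t) = 1.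
Proof.
by apply/eqP; rewrite -sqrp_eq1 ?cmod_ge0 // sqr_cmod /= cos2Dsin2.
Qed.

Lemma cisX t n : cis t ^+ n = cis (n%:R * t).
Proof.
elim: n => [|n IH]; first by rewrite expr0 mul0r /cis cos0 sin0.
rewrite exprSr IH -natr1 mulrDl mul1r /cis cosD sinD.
by apply/eqP; rewrite eq_complex /=; apply/andP; split; apply/eqP; ring.
Qed.

(** Only real parts of powers matter below, and these do not see the sign of
    the argument, so it can be taken in [[0, pi]]. *)
Lemma polarX z : 0 < cmod z -> exists2 t, 0 <= t <= pi &
  forall n, complex.Re (z ^+ n) = cmod z ^+ n * cos (n%:R * t).
Proof.
move=> z0; set x := complex.Re z / cmod z.
have x1 : -1 <= x <= 1.
  rewrite -ler_norml normrM normfV (gtr0_norm z0) ler_pdivrMr // mul1r.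
  by rewrite -ler_sqr ?nnegrE ?cmod_ge0 // real_normK ?num_real // sqr_cmod
    lerDl sqr_ge0.
have [t0 ct] := acos_def x1; set t := acos x in t0 ct.
have ReE : complex.Re z = cmod z * cos t by rewrite ct /x mulrC divfK // gt_eqF.
have ImE : complex.Im z ^+ 2 = (cmod z * sin t) ^+ 2.
  apply: (addrI (complex.Re z ^+ 2)); rewrite -sqr_cmod ReE !exprMn -mulrDr.
  by rewrite cos2Dsin2 mulr1.
have polar s : cos s = cos t -> complex.Im z = cmod z * sin s ->
    z = (cmod z)%:C * cis s.
  by move=> cs Is; apply/eqP; rewrite eq_complex /= ReE Is cs !mul0r subr0 addr0
    !eqxx.
have Re_polar s n : z = (cmod z)%:C * cis s ->
    complex.Re (z ^+ n) = cmod z ^+ n * cos (n%:R * s).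
  by move=> {1}->; rewrite exprMn cisX -rmorphXn /= mul0r subr0.
exists t => // n.
move/eqP: ImE; rewrite eqf_sqr => /orP[] /eqP ImE.
  exact/Re_polar/polar.
rewrite -cosN -mulrN; apply/Re_polar/polar; first by rewrite cosN.
by rewrite sinN mulrN.
Qed.

End ComplexModulus.

(** * A power far from one *)

Section FarPower.
Context {R : realType}.
Implicit Types (rho t x : R) (n : nat).

(** Pair the terms of index [k] and [n - 1 - k]: multiplied by [x] they are
    [a] and [b] with [a b = x ^ (2 n)], and [a + b <= 1 + a b] since [1 - a] and
    [1 - b] have the same sign. *)
Lemma geometric_sum_le x n : 0 <= x ->
  2 * x * (\sum_(k < n) (x ^+ 2) ^+ k) <= n%:R * (1 + (x ^+ 2) ^+ n).
Proof.
move=> x0; set S := \sum_(k < n) _.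
have -> : 2 * x * S =
    \sum_(k < n) (x ^+ (2 * k).+1 + x ^+ (2 * (n - k.+1)).+1).
  rewrite big_split /= [X in _ = _ + X](reindex_inj rev_ord_inj) /=.
  rewrite -[2 * x]/((1 + 1) * x) 2!mulrDl !mul1r mulr_sumr; congr (_ + _).
    by apply: eq_bigr => k _; rewrite [RHS]exprS exprM.
  apply: eq_bigr => k _; rewrite -exprM -exprS; congr (_ ^+ _).
  by have := ltn_ord k; lia.
rewrite mulr_natl -[X in _ *+ X]card_ord -sumr_const; apply: ler_sum => k _.
have -> : (x ^+ 2) ^+ n = x ^+ (2 * k).+1 * x ^+ (2 * (n - k.+1)).+1.
  rewrite -exprM -exprD; congr (_ ^+ _); have := ltn_ord k; lia.
rewrite -subr_ge0.
set a := x ^+ _; set b := x ^+ _.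
have -> : 1 + a * b - (a + b) = (1 - a) * (1 - b) by ring.
have [x1|/ltW x1] := leP x 1.
  by rewrite mulr_ge0 // subr_ge0 exprn_ile1.
by rewrite mulr_le0 // subr_le0 exprn_ege1.
Qed.

Lemma expr_unbounded rho (B : R) : 1 < rho -> exists n, B <= rho ^+ n.
Proof.
move=> rho1.
have bern n : 1 + n%:R * (rho - 1) <= rho ^+ n.
  elim: n => [|n IH]; first by rewrite mul0r addr0 expr0.
  have p1 : 1 <= rho ^+ n by rewrite exprn_ege1 // ltW.
  rewrite exprSr -natr1.
  have : 0 <= (rho ^+ n - 1) * (rho - 1) by rewrite mulr_ge0; lra.
  lra.
exists (Num.bound `|B / (rho - 1)|); apply: le_trans (bern _).
have /ltW : `|B / (rho - 1)| < _ := archi_boundP (normr_ge0 _).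
move/(le_trans (ler_norm _)); rewrite ler_pdivrMr ?subr_gt0 //; lra.
Qed.

(** Here [d n = |lam ^ n - 1|^2] for [lam = rho exp (i t)].  If [t = 0], any
    large [n] works.  Otherwise [n] is the least index with
    [n t >= 2 pi / 3]; then [n t <= 4 pi / 3], hence [cos (n t) <= -1/2] and
    [d n >= rho^(2n) + rho^n + 1 >= 3].  For [n >= 3] minimality gives
    [n t <= pi], and then the two crude estimates
    [2 (1 - cos t) <= t^2 <= 12 / n^2] and [geometric_sum_le] suffice.  For
    [n = 2] they do not: the second inequality is an equality in the limit
    [rho -> 1, t -> 2 pi / 3], so [d 2] is factored as
    [|lam - 1|^2 |lam + 1|^2] instead. *)
Lemma exists_far_power_polar rho t : 1 < rho -> 0 <= t <= pi ->
  let d n := (rho ^+ n) ^+ 2 + 1 - 2 * rho ^+ n * cos (n%:R * t) in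
  exists n, [/\ (0 < n)%N, 3 <= d n &
    d 1%N * (\sum_(k < n) rho ^+ k) ^+ 2 <= 4 * d n].
Proof.
move=> rho1 /andP[t0 tpi] d.
have pi0 := pi_gt0 R.
have rho0 : 0 <= rho by lra.
have geom n : (rho - 1) * (\sum_(k < n) rho ^+ k) = rho ^+ n - 1.
  by rewrite subrX1.
have P1 n : 1 <= rho ^+ n by rewrite exprn_ege1 // ltW.
have [t_eq0|tn0] := eqVneq t 0.
  have dE n : d n = (rho ^+ n - 1) ^+ 2.
    by rewrite /d t_eq0 mulr0 cos0; ring.
  have [n Pn] := expr_unbounded rho 3 rho1.
  exists n; rewrite !dE expr1 -exprMn geom; split.
  - by case: n Pn => //; rewrite expr0; lra.
  - nra.
  - by have := sqr_ge0 (rho ^+ n - 1); lra.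
have {tn0}t0' : 0 < t by rewrite lt_neqAle eq_sym tn0.
have d_ge n : cos (n%:R * t) <= - (1 / 2) ->
    (rho ^+ n) ^+ 2 + 1 + rho ^+ n <= d n.
  move=> c; rewrite /d.
  have : 0 <= rho ^+ n * (- (1 / 2) - cos (n%:R * t)).
    by rewrite mulr_ge0 ?subr_ge0 // (le_trans ler01).
  lra.
have ex : exists n, 2 * pi / 3 <= n%:R * t.
  exists (Num.bound (2 * pi / 3 / t)).
  rewrite -ler_pdivrMr //; apply/ltW/archi_boundP.
  by rewrite !divr_ge0 // mulr_ge0 // ltW.
case: (ex_minnP ex) => n nt min_n.
have n0 : (0 < n)%N by case: n nt {min_n} => //; rewrite mul0r; lra.
have n_pred : (n%:R - 1) * t < 2 * pi / 3.
  rewrite -(prednK n0) -natr1 addrK ltNge; apply/negP => /min_n.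
  by rewrite leqNgt prednK // leqnn.
have cos_n : n%:R * t <= 4 * pi / 3 -> cos (n%:R * t) <= - (1 / 2).
  by move=> h; apply: cos_le_mhalf; rewrite nt h.
case: n n0 nt {min_n} n_pred cos_n => [//|[|[|m]]] n0 nt n_pred cos_n.
- have d1 : 3 <= d 1%N.
    have /(d_ge 1%N) : cos (1 * t) <= - (1 / 2) by apply: cos_n; lra.
    have := P1 1%N; rewrite expr1; nra.
  exists 1%N; split => //.
  by rewrite big_ord1 expr0 expr1n mulr1; lra.
- have d2 : 3 <= d 2%N.
    have /(d_ge 2%N) : cos (2 * t) <= - (1 / 2) by apply: cos_n; lra.
    have := P1 2%N; nra.
  exists 2%N; split => //.
  have ct : - (1 / 2) <= cos t.
    by rewrite -cos_two_thirds_pi leNgt ltr_cos ?in_itv /= -?leNgt; lra.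
  rewrite big_ord_recl big_ord1 /= expr0 expr1 /d expr1 mul1r.
  have -> : cos (2 * t) = 2 * cos t ^+ 2 - 1.
    have -> : 2 * t = t + t by ring.
    by rewrite cosD; have := cos2Dsin2 t; lra.
  set c := cos t in ct *.
  have c1 : c <= 1 by exact: cos_le1.
  (* d 2 = |lam - 1|^2 |lam + 1|^2 *)
  have -> : (rho ^+ 2) ^+ 2 + 1 - 2 * rho ^+ 2 * (2 * c ^+ 2 - 1) =
    (rho ^+ 2 + 1 - 2 * rho * c) * (rho ^+ 2 + 1 + 2 * rho * c) by ring.
  have A0 : 0 <= rho ^+ 2 + 1 - 2 * rho * c.
    have : 0 <= rho * (1 - c) by rewrite mulr_ge0 // subr_ge0.
    have := sqr_ge0 (rho - 1); lra.
  have B0 : (1 + rho) ^+ 2 <= 4 * (rho ^+ 2 + 1 + 2 * rho * c).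
    have : 0 <= rho * (c + 1 / 2) by rewrite mulr_ge0 //; lra.
    have := sqr_ge0 (rho - 1); lra.
  have := ler_wpM2l A0 B0; lra.
set n := m.+3 in n0 nt n_pred cos_n *.
have n3 : 3 <= n%:R :> R by rewrite ler_nat.
have ntpi : n%:R * t <= pi.
  have : n%:R <= 3 / 2 * (n%:R - 1) :> R by lra.
  move/(ler_wpM2r t0); lra.
have dn : (rho ^+ n) ^+ 2 + 1 + rho ^+ n <= d n.
  by apply/d_ge/cos_n; lra.
have Pn := P1 n.
exists n; split => //.
  nra.
set S := \sum_(k < n) _; set P := rho ^+ n in Pn dn *.
have S0 : 0 <= S by apply: sumr_ge0 => k _; rewrite exprn_ge0.
(* geometric_sum_le squared, at the square root of rho *)
have rS : rho * S ^+ 2 * 4 <= n%:R ^+ 2 * (1 + P) ^+ 2.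
  have sr : Num.sqrt rho ^+ 2 = rho by rewrite sqr_sqrtr.
  have := @geometric_sum_le (Num.sqrt rho) n (sqrtr_ge0 _).
  rewrite sr -/S -/P => h.
  have -> : rho * S ^+ 2 * 4 = (2 * Num.sqrt rho * S) ^+ 2.
    by rewrite !exprMn sr; ring.
  rewrite -exprMn ler_sqr // nnegrE !mulr_ge0 ?sqrtr_ge0 //; lra.
have nt12 : (n%:R * t) ^+ 2 <= 12.
  have -> : (12 : R) = (2 * Num.sqrt 3) ^+ 2 by rewrite exprMn sqr_sqrtr; lra.
  rewrite ler_sqr ?nnegrE ?mulr_ge0 ?sqrtr_ge0 //.
  exact: le_trans ntpi pi_le.
have d1 : d 1%N <= (rho - 1) ^+ 2 + rho * t ^+ 2.
  have := ler_wpM2l rho0 (one_sub_cos_le _ t0).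
  rewrite /d expr1 mul1r; lra.
have := geom n; rewrite -/S -/P => SP.
have : rho * t ^+ 2 * S ^+ 2 <= 3 * (1 + P) ^+ 2.
  have h1 := ler_wpM2r (sqr_ge0 t) rS.
  have h2 := ler_wpM2r (sqr_ge0 (1 + P)) nt12.
  lra.
have h3 := ler_wpM2r (sqr_ge0 S) d1.
have h4 : ((rho - 1) * S) ^+ 2 = (P - 1) ^+ 2 by rewrite SP.
rewrite exprMn in h4.
lra.
Qed.

Lemma exists_far_power (lam : R[i]) : 1 < cmod lam ->
  exists n, [/\ (0 < n)%N, Num.sqrt 3 <= cmod (lam ^+ n - 1) &
    cmod (lam - 1) * (\sum_(k < n) cmod lam ^+ k) <= 2 * cmod (lam ^+ n - 1)].
Proof.
move=> lam1; have [|t t0 Re_pow] := @polarX R lam; first by lra.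
have dE n : cmod (lam ^+ n - 1) ^+ 2 =
    (cmod lam ^+ n) ^+ 2 + 1 - 2 * cmod lam ^+ n * cos (n%:R * t).
  by rewrite sqr_cmod_sub1 cmodX Re_pow mulrA.
have [n [n0 d3 d1]] := exists_far_power_polar _ _ lam1 t0.
have S0 : 0 <= \sum_(k < n) cmod lam ^+ k.
  by apply: sumr_ge0 => k _; rewrite exprn_ge0 // cmod_ge0.
rewrite -!dE expr1 in d3 d1.
exists n; split => //.
  by rewrite -ler_sqr ?nnegrE ?sqrtr_ge0 ?cmod_ge0 // sqr_sqrtr.
rewrite -ler_sqr ?nnegrE ?mulr_ge0 ?cmod_ge0 // !exprMn.
by rewrite (_ : 2 ^+ 2 = 4) //; lra.
Qed.

End FarPower.

(** * Real-valued norm and operator norm *)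

Section RealNorm.
Context {R : realType} {X : normedModType R[i]}.
Implicit Types (x y : X) (z : R[i]).

Lemma real_rnorm x : (rnorm x)%:C = `|x|.
Proof. by rewrite /rnorm RRe_real // normr_real. Qed.

Lemma rnorm_ge0 x : 0 <= rnorm x.
Proof. by rewrite -ler0c real_rnorm. Qed.

Lemma rnorm0 : rnorm (0 : X) = 0.
Proof. by rewrite /rnorm normr0. Qed.

Lemma rnorm_eq0 x : (rnorm x == 0) = (x == 0).
Proof. by rewrite -(inj_eq (@complexI R)) real_rnorm normr_eq0. Qed.

Lemma rnormZ z x : rnorm (z *: x) = cmod z * rnorm x.
Proof.
apply: (@complexI R).
by rewrite rmorphM /= real_rnorm normrZ real_cmod real_rnorm.
Qed.

Lemma rnormD x y : rnorm (x + y) <= rnorm x + rnorm y.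
Proof. by rewrite -lecR rmorphD /= !real_rnorm ler_normD. Qed.

Lemma rnormN x : rnorm (- x) = rnorm x.
Proof. by rewrite /rnorm normrN. Qed.

Lemma rnormB x y : rnorm (x - y) <= rnorm x + rnorm y.
Proof. by rewrite -(rnormN y) rnormD. Qed.

Lemma ler_rnorm_sub x y : rnorm x - rnorm y <= rnorm (x - y).
Proof. by have := rnormD (x - y) y; rewrite subrK lerBlDr. Qed.

Lemma rnorm_sum n (F : 'I_n -> X) :
  rnorm (\sum_(k < n) F k) <= \sum_(k < n) rnorm (F k).
Proof.
elim/big_ind2 : _ => //; first by rewrite rnorm0.
by move=> x a y b xa yb; rewrite (le_trans (rnormD _ _)) // lerD.
Qed.

End RealNorm.

Section OperatorNorm.
Context {R : realType} {X : normedModType R[i]}.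
Implicit Types (f : X -> X) (T S : {linear X -> X}) (c M : R).

Lemma opnorm_le f c : 0 <= c -> (forall x, rnorm (f x) <= c * rnorm x) ->
  (opnorm f <= c%:E)%E.
Proof.
move=> c0 fc; apply: ge_ereal_sup => _ [x /= x1 <-].
by rewrite lee_fin (le_trans (fc x)) // ler_piMr.
Qed.

Lemma scalable0 f : scalable f -> f 0 = 0.
Proof. by move=> /(_ 0 0); rewrite !scale0r. Qed.

Lemma opnorm_leP f c : scalable f -> (opnorm f <= c%:E)%E ->
  forall x, rnorm (f x) <= c * rnorm x.
Proof.
move=> fZ fc x; have [->|x0] := eqVneq x 0.
  by rewrite scalable0 // rnorm0 mulr0.
have nx : 0 < rnorm x by rewrite lt_neqAle rnorm_ge0 eq_sym rnorm_eq0 x0.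
have : rnorm (f ((rnorm x)^-1%:C *: x)) <= c.
  rewrite -lee_fin; apply: le_trans fc; apply: ereal_sup_ubound.
  exists ((rnorm x)^-1%:C *: x) => //=.
  by rewrite rnormZ cmod_real gtr0_norm ?invr_gt0 // mulVf // gt_eqF.
rewrite fZ rnormZ cmod_real gtr0_norm ?invr_gt0 //.
by rewrite ler_pdivrMl // mulrC.
Qed.

Lemma opnorm_ge0 f : scalable f -> (0 <= opnorm f)%E.
Proof.
move=> fZ; apply: ereal_sup_ubound; exists 0 => /=; first by rewrite rnorm0.
by rewrite scalable0 // rnorm0.
Qed.

Lemma iter_scalable T n : scalable (iter n T).
Proof. by move=> a x; elim: n => //= n ->; rewrite linearZ. Qed.

Lemma iter_additive T n x y : iter n T (x + y) = iter n T x + iter n T y.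
Proof. by elim: n => //= n ->; rewrite linearD. Qed.

Lemma iter_resolvent T (lam : R[i]) n x :
  iter n T (lam *: x - T x) = lam *: iter n T x - iter n.+1 T x.
Proof.
rewrite iter_additive iter_scalable -scaleN1r iter_scalable scaleN1r.
by rewrite (iterSr n T x).
Qed.

Lemma dev_scalable T n : scalable (fun x => x - iter n T x).
Proof. by move=> a x; rewrite iter_scalable scalerBr. Qed.

(** The factorisation of [lam^n - T^n] by [lam - T]. *)
Lemma expr_sub_iterE T (lam : R[i]) n x :
  lam ^+ n *: x - iter n T x =
    \sum_(k < n) lam ^+ (n - k.+1) *: iter k T (lam *: x - T x).
Proof.
elim: n => [|n IH]; first by rewrite big_ord0 expr0 scale1r subrr.
rewrite big_ord_recr /= subnn expr0 scale1r.
have -> : \sum_(i < n) lam ^+ (n.+1 - i.+1) *: iter i T (lam *: x - T x) =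
    lam *: (lam ^+ n *: x - iter n T x).
  rewrite IH scaler_sumr; apply: eq_bigr => k _.
  by rewrite scalerA -exprS -subSn.
rewrite scalerBr scalerA -exprS iter_resolvent.
by rewrite addrA subrK.
Qed.

(** With [d = |lam ^ n - 1| >= sqrt 3] one has
    [(sqrt 3 - q) d <= sqrt 3 (d - q)]; this trades the difference [d - q],
    which comes out of the telescoping identity, for a multiple of [d] that
    cancels against [|lam - 1| S <= 2 d]. *)
Lemma resolvent_lower_bound T (q M : R) (lam : R[i]) x :
  0 <= q -> q < Num.sqrt 3 -> 0 <= M ->
  (forall n x, (0 < n)%N -> rnorm (x - iter n T x) <= q * rnorm x) ->
  (forall n x, rnorm (iter n T x) <= M * rnorm x) ->
  1 < cmod lam ->
  cmod (lam - 1) * rnorm x <=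
    2 * Num.sqrt 3 / (Num.sqrt 3 - q) * M * rnorm (lam *: x - T x).
Proof.
move=> q0 q3 M0 dev pow lam1.
have [n [n0 d3 dS]] := exists_far_power _ lam1.
set d := cmod _ in d3 dS; set S := \sum_(k < n) _ in dS.
set y := lam *: x - T x.
set s : R := Num.sqrt 3 in q3 d3 *.
have S0 : 0 <= S by apply: sumr_ge0 => k _; rewrite exprn_ge0 // cmod_ge0.
have sum_le : rnorm (lam ^+ n *: x - iter n T x) <= S * (M * rnorm y).
  rewrite expr_sub_iterE (le_trans (rnorm_sum _ _)) // /S.
  rewrite (reindex_inj rev_ord_inj) /= mulr_suml; apply: ler_sum => k _.
  have -> : (n - (n - k.+1).+1 = k)%N by have := ltn_ord k; lia.
  by rewrite rnormZ cmodX ler_wpM2l ?exprn_ge0 ?cmod_ge0.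
have split_x : (lam ^+ n - 1) *: x =
    (lam ^+ n *: x - iter n T x) - (x - iter n T x).
  by rewrite scalerBl scale1r opprB addrA addrNK.
have dx : d * rnorm x <= S * (M * rnorm y) + q * rnorm x.
  by rewrite -rnormZ split_x (le_trans (rnormB _ _)) // lerD //; exact: dev.
have s0 : 0 < s by rewrite sqrtr_gt0.
have x0 := rnorm_ge0 x.
have y0 := rnorm_ge0 y.
have My0 : 0 <= M * rnorm y by rewrite mulr_ge0.
have d0 : 0 < d by apply: lt_le_trans d3.
have key : d * (cmod (lam - 1) * rnorm x * (s - q)) <=
    d * (2 * s * M * rnorm y).
  have h1 : (s - q) * d * rnorm x <= s * (S * (M * rnorm y)).
    have h : 0 <= q * (d - s) * rnorm x by rewrite !mulr_ge0 ?subr_ge0.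
    have := ler_wpM2l (ltW s0) dx; lra.
  have h2 := ler_wpM2l (cmod_ge0 (lam - 1)) h1.
  have h3 := ler_wpM2r (mulr_ge0 (ltW s0) My0) dS.
  lra.
rewrite ler_pM2l // in key.
rewrite -[2 * s / _]mulrC -!mulrA ler_pdivlMl ?subr_gt0 // mulrC.
by rewrite !mulrA in key *.
Qed.

End OperatorNorm.

(** * Neumann series *)

Section CompleteSpaces.
Context {R : realType}.

Lemma cvg_rnormP (X : normedModType R[i]) (u : nat -> X) (l : X) :
  u @ \oo --> l <-> forall e : R, 0 < e ->
    exists N, forall n, (N <= n)%N -> rnorm (l - u n) <= e.
Proof.
split=> [/cvgrPdist_le ul e e0|ul].
  have [|N _ uN] := ul e%:C; first by rewrite ltcR.
  by exists N => n Nn; rewrite -lecR real_rnorm; exact: uN.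
apply/cvgrPdist_le => e e0.
have /complex_realP[r er] : e \is Num.real by rewrite gtr0_real.
have [|N uN] := ul r; first by rewrite -ltcR -er.
exists N => // n /= Nn; rewrite er -real_rnorm lecR; exact: uN.
Qed.

Lemma cauchy_rnorm_cvg (X : completeNormedModType R[i]) (u : nat -> X) :
  (forall e : R, 0 < e ->
     exists N, forall p, rnorm (u (N + p)%N - u N) <= e) ->
  cvg (u @ \oo).
Proof.
move=> u_cauchy.
have eventually_shift (P : set nat) N : (forall p, P (N + p)%N) -> (\oo P).
  by move=> PN; exists N => // n /= Nn; rewrite -(subnKC Nn).
have pos_real (e : R[i]) : 0 < e -> exists2 r : R, 0 < r & e = r%:C.
  move=> e0; have /complex_realP[r er] : e \is Num.real by rewrite gtr0_real.
  by exists r => //; rewrite -ltcR -er.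
have cu : cauchy (u @ \oo).
  apply: cauchy_exP => e /pos_real[r r0 ->].
  have [|N uN] := u_cauchy (r / 2); first by rewrite divr_gt0.
  exists (u N); apply: (eventually_shift _ N) => p.
  rewrite -ball_normE /= distrC -real_rnorm ltcR (le_lt_trans (uN p)) //; lra.
exact: cauchy_cvg.
Qed.

Lemma expr_small (t e : R) : 0 <= t < 1 -> 0 < e -> exists N, t ^+ N <= e.
Proof.
move=> /andP[t0 t1] e0; have [->|tn0] := eqVneq t 0.
  by exists 1%N; rewrite expr1 ltW.
have {tn0}t0 : 0 < t by rewrite lt_neqAle eq_sym tn0.
have [|n] := expr_unbounded t^-1 e^-1; first by rewrite invf_gt1.
by rewrite exprVn lef_pV2 ?posrE ?exprn_gt0 // => te; exists n.
Qed.

Lemma linear_map_of (X : normedModType R[i]) (f : X -> X) :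
  linear f -> exists S : {linear X -> X}, S =1 f.
Proof.
move=> flin.
by exists (HB.pack_for {linear X -> X} f (GRing.isLinear.Build _ _ _ _ f flin)).
Qed.

End CompleteSpaces.

Section Neumann.
Context {R : realType} {X : completeNormedModType R[i]}.
Context (T : {linear X -> X}) (M : R) (lam : R[i]) (M0 : 0 <= M).
Context (powT : forall n x, rnorm (iter n T x) <= M * rnorm x).
Context (lam1 : 1 < cmod lam).

Let t := cmod lam^-1.

Let t01 : 0 < t < 1.
Proof. by rewrite /t cmodV invr_gt0 invf_lt1 (lt_trans ltr01). Qed.

Definition neumann N (y : X) : X :=
  \sum_(k < N) (lam^-1) ^+ k.+1 *: iter k T y.

Let lam_neq0 : lam != 0.
Proof. by rewrite -cmod_eq0 gt_eqF // (lt_trans ltr01). Qed.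

Lemma neumann_linear N : linear (neumann N).
Proof.
move=> a x y; rewrite /neumann scaler_sumr -big_split /=.
apply: eq_bigr => k _.
by rewrite iter_additive iter_scalable scalerDr !scalerA mulrC.
Qed.

Lemma neumannT N x : neumann N (T x) = T (neumann N x).
Proof.
rewrite /neumann linear_sum; apply: eq_bigr => k _.
by rewrite linearZ -(iterSr k T x).
Qed.

Lemma neumann_resolvent N x :
  neumann N (lam *: x - T x) = lam *: neumann N x - T (neumann N x).
Proof.
have n0 : neumann N 0 = 0.
  rewrite /neumann big1 // => k _.
  by rewrite (scalable0 _ (iter_scalable T k)) scaler0.
rewrite neumann_linear -neumannT; congr (_ + _).
by rewrite -scaleN1r -[_ *: T x]addr0 neumann_linear n0 addr0 scaleN1r.
Qed.

Lemma neumann_sub N x :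
  neumann N (lam *: x - T x) = x - (lam^-1) ^+ N *: iter N T x.
Proof.
elim: N => [|N IH]; first by rewrite /neumann big_ord0 scale1r subrr.
rewrite /neumann big_ord_recr /= -/(neumann _ _) IH.
rewrite iter_resolvent scalerBr scalerA [X in X * lam]exprSr mulfVK //.
by rewrite addrA subrK.
Qed.

(* The sum of the bounds M * t ^ k for k >= 1. *)
Let K := M * t / (1 - t).

Let K0 : 0 <= K.
Proof.
by case/andP: t01 => t0 t1; rewrite divr_ge0 ?mulr_ge0 ?subr_ge0 // ltW.
Qed.

(** The exact geometric tail on the right, rather than its bound [K t^N], is
    what makes the induction on [p] close. *)
Lemma neumann_tail N p y :
  rnorm (neumann (N + p) y - neumann N y)
    <= K * (t ^+ N - t ^+ (N + p)) * rnorm y.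
Proof.
case/andP: t01 => t0 t1; elim: p => [|p IH].
  by rewrite addn0 !subrr rnorm0 mulr0 mul0r.
rewrite addnS {1}/neumann big_ord_recr /= -/(neumann _ _) addrAC.
apply: le_trans (rnormD _ _) _.
have -> : K * (t ^+ N - t ^+ (N + p).+1) * rnorm y =
    K * (t ^+ N - t ^+ (N + p)) * rnorm y + t ^+ (N + p).+1 * (M * rnorm y).
  have : K * (1 - t) = M * t by rewrite divfK // subr_eq0 gt_eqF.
  rewrite exprSr => KE.
  have -> : t ^+ (N + p) * t * (M * rnorm y) =
    t ^+ (N + p) * (M * t) * rnorm y by ring.
  rewrite -KE; ring.
apply: lerD => //; rewrite rnormZ cmodX ler_wpM2l // exprn_ge0 //.
exact: cmod_ge0.
Qed.

Lemma neumann_cauchy N p y :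
  rnorm (neumann (N + p) y - neumann N y) <= K * rnorm y * t ^+ N.
Proof.
case/andP: t01 => t0 t1; apply: le_trans (neumann_tail _ _ _) _.
rewrite -mulrA -[leRHS]mulrA ler_wpM2l // mulrC ler_wpM2l ?rnorm_ge0 //.
by rewrite gerBl exprn_ge0 // ltW.
Qed.

Lemma neumann_cvg y : cvg (neumann ^~ y @ \oo).
Proof.
apply: cauchy_rnorm_cvg => e e0.
have [||N tN] := @expr_small R t (e / (1 + K * rnorm y)).
- by case/andP: t01 => /ltW -> ->.
- by rewrite divr_gt0 // ltr_pwDl // mulr_ge0 ?rnorm_ge0.
have Ky : 0 <= K * rnorm y by rewrite mulr_ge0 ?rnorm_ge0.
exists N => p; apply: le_trans (neumann_cauchy _ _ _) _.
apply: le_trans (ler_wpM2l Ky tN) _.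
rewrite mulrCA ler_piMr ?(ltW e0) // ler_pdivrMr ?mul1r ?lerDr //.
by rewrite ltr_pwDl.
Qed.

Let tail_cvg0 x : (fun N => x - (lam^-1) ^+ N *: iter N T x) @ \oo --> x.
Proof.
apply/cvg_rnormP => e e0.
have My : 0 <= M * rnorm x by rewrite mulr_ge0 ?rnorm_ge0.
have [||N tN] := @expr_small R t (e / (1 + M * rnorm x)).
- by case/andP: t01 => /ltW -> ->.
- by rewrite divr_gt0 // ltr_pwDl.
case/andP: t01 => t0 /ltW t1.
exists N => n Nn; rewrite opprB addrC subrK rnormZ cmodX.
apply: le_trans (_ : t ^+ N * (M * rnorm x) <= _).
  by rewrite ler_pM ?exprn_ge0 ?cmod_ge0 ?rnorm_ge0 // ler_wiXn2l // ltW.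
apply: le_trans (ler_wpM2r My tN) _.
rewrite -mulrA ler_piMr ?(ltW e0) // ler_pdivrMl ?mulr1 ?lerDr //.
by rewrite ltr_pwDl.
Qed.

(** The limit of the partial sums inverts [lam - T] on both sides: on vectors
    [lam x - T x] the partial sums telescope, and they commute with [T], which
    is continuous. *)
Lemma resolvent_exists : exists S, is_resolvent T lam S.
Proof.
pose s y := lim (neumann ^~ y @ \oo).
have s_cvg y : neumann ^~ y @ \oo --> s y by exact: neumann_cvg.
have uniq_s y (l : X) : neumann ^~ y @ \oo --> l -> s y = l.
  by move=> ul; apply: cvg_lim ul; exact: norm_hausdorff.
have [|S SE] := linear_map_of _ s.
  move=> a x y; apply: uniq_s.
  under eq_fun do rewrite neumann_linear.
  by apply: cvgD => //; exact: cvgZl_tmp.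
exists S; split.
- apply: (@le_lt_trans _ _ K%:E); last exact: ltry.
  apply: opnorm_le => // y; rewrite SE; apply/ler_addgt0Pr => e e0.
  have [N /(_ N (leqnn N)) sN] := (cvg_rnormP _ _ _).1 (s_cvg y) e e0.
  have := neumann_cauchy 0 N y; rewrite add0n expr0 mulr1.
  rewrite {2}/neumann big_ord0 subr0 => KN.
  have := ler_rnorm_sub (s y) (neumann N y); lra.
- move=> x; rewrite SE; apply: uniq_s.
  under eq_fun do rewrite neumann_sub.
  exact: tail_cvg0.
- move=> y; rewrite SE.
  have T_cvg : (fun N => T (neumann N y)) @ \oo --> T (s y).
    apply/cvg_rnormP => e e0.
    have [|N uN] := (cvg_rnormP _ _ _).1 (s_cvg y) (e / (1 + M)).
      by rewrite divr_gt0 // ltr_pwDl.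
    exists N => n /uN un; rewrite -linearB; apply: le_trans (powT 1%N _) _.
    apply: le_trans (ler_wpM2l M0 un) _.
    rewrite mulrCA ler_piMr ?(ltW e0) // ler_pdivrMr ?mul1r ?lerDr //.
    by rewrite ltr_pwDl.
  have h : (fun N => lam *: neumann N y - T (neumann N y)) @ \oo -->
      lam *: s y - T (s y).
    by apply: cvgB T_cvg; exact: cvgZl_tmp.
  have h' : (fun N => lam *: neumann N y - T (neumann N y)) @ \oo --> y.
    have -> : (fun N => lam *: neumann N y - T (neumann N y)) =
        (fun N => y - (lam^-1) ^+ N *: iter N T y).
      by apply/funext => N; rewrite -neumann_sub neumann_resolvent.
    exact: tail_cvg0.
  exact: cvg_unique h h'.
Qed.

End Neumann.

(** * The upper bound *)

Section RittTheorem.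
Context {R : realType} {X : completeNormedModType R[i]}.
Implicit Types (T : {linear X -> X}) (q : R).

Lemma power_dev_le T q n x : (power_dev T <= q%:E)%E -> (0 < n)%N ->
  rnorm (x - iter n T x) <= q * rnorm x.
Proof.
move=> devT n0; apply: (opnorm_leP (fun y => y - iter n T y)).
  exact: dev_scalable.
by apply: le_trans devT; apply: ereal_sup_ubound; exists n.
Qed.

Lemma power_bound_fin T q : 0 <= q -> (power_dev T <= q%:E)%E ->
  exists2 M, 0 <= M <= 1 + q & power_bound T = M%:E.
Proof.
move=> q0 devT; have q10 : 0 <= 1 + q by rewrite addr_ge0.
have p0 : (0 <= power_bound T)%E.
  apply: le_trans (opnorm_ge0 _ (iter_scalable T 0)) _.
  by apply: ereal_sup_ubound; exists 0%N.
have p1 : (power_bound T <= (1 + q)%:E)%E.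
  apply: ge_ereal_sup => _ [n _ <-]; apply: opnorm_le => // x.
  have x0 := rnorm_ge0 x.
  case: n => [|n] /=; first by rewrite mulrDl mul1r lerDl mulr_ge0.
  have := power_dev_le _ _ n.+1 x devT isT => dx.
  have := rnormB x (x - iter n.+1 T x).
  rewrite opprB addrC subrK mulrDl mul1r => h.
  by apply: le_trans h _; rewrite lerD2l.
exists (fine (power_bound T)).
  rewrite fine_ge0 // -lee_fin fineK // ge0_fin_numE //.
  by rewrite (le_lt_trans p1) ?ltry.
by rewrite fineK // ge0_fin_numE // (le_lt_trans p1) ?ltry.
Qed.

Lemma ritt_of_power_dev T q : 1 <= q -> q < Num.sqrt 3 ->
  bounded_op T -> (power_dev T <= q%:E)%E ->
  [/\ ritt T,
      (ritt_const T <= (2 * Num.sqrt 3 / (Num.sqrt 3 - q))%:E * power_bound T)%E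
    & ((2 * Num.sqrt 3 / (Num.sqrt 3 - q))%:E * power_bound T <=
       ((6 + 2 * Num.sqrt 3) / (Num.sqrt 3 - q))%:E)%E].
Proof.
move=> q1 q3 bT devT; have q0 : 0 <= q by lra.
have [M /andP[M0 Mq] ME] := power_bound_fin _ _ q0 devT.
set s : R := Num.sqrt 3 in q3 *; set C := 2 * s / (s - q).
have s0 : 0 <= s by rewrite sqrtr_ge0.
have s2 : s ^+ 2 = 3 by rewrite sqr_sqrtr.
have C0 : 0 <= C by rewrite divr_ge0 ?mulr_ge0 // subr_ge0 ltW.
have powT n x : rnorm (iter n T x) <= M * rnorm x.
  apply: opnorm_leP; first exact: iter_scalable.
  by rewrite -ME; apply: ereal_sup_ubound; exists n.
have resT (lam : R[i]) : 1 < cmod lam -> exists S, is_resolvent T lam S.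
  by move=> lam1; exact: (resolvent_exists _ _ _ M0 powT lam1).
have rC : (ritt_const T <= C%:E * power_bound T)%E.
  rewrite ME -EFinM; apply: ge_ereal_sup => _ [lam /= lam1 <-].
  have [S Sres] := resT _ lam1.
  have l0 : 0 < cmod (lam - 1).
    by have := ler_cmod_sub lam 1; rewrite cmod1; lra.
  have : (resolvent_norm T lam <= (C * M / cmod (lam - 1))%:E)%E.
    apply: (@le_trans _ _ (opnorm S)).
      by apply: ereal_inf_lbound; exists S.
    apply: opnorm_le => [|y].
      by apply: divr_ge0; [exact: mulr_ge0|exact: cmod_ge0].
    have := resolvent_lower_bound _ _ _ _ (S y) q0 q3 M0
      (fun n x => power_dev_le _ _ n x devT) powT lam1.
    case: Sres => _ _ ->; rewrite -/s -/C => h.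
    by rewrite mulrAC ler_pdivlMr // mulrC.
  move/(lee_wpmul2l (_ : (0 <= (cmod (lam - 1))%:E)%E)).
  rewrite lee_fin => /(_ (ltW l0)) /le_trans; apply.
  by rewrite -EFinM lee_fin mulrC divfK // gt_eqF.
have CM : (C%:E * power_bound T <= ((6 + 2 * s) / (s - q))%:E)%E.
  rewrite ME -EFinM lee_fin /C mulrAC.
  rewrite ler_wpM2r ?invr_ge0 ?subr_ge0 ?(ltW q3) //.
  have : s * M <= s * (1 + s) by rewrite ler_wpM2l //; lra.
  by rewrite mulrDr -expr2 s2; lra.
split=> //; split=> //; last first.
  by apply: le_lt_trans rC _; apply: le_lt_trans CM _; rewrite ltry.
move=> lam; rewrite /spectrum /closed_unit_disc /= => nres.
by rewrite leNgt; apply/negP => /resT.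
Qed.

End RittTheorem.

(** * Scalar operators *)

Section ScalarOperators.
Context {R : realType} {X : normedModType R[i]}.
Context (X_neq0 : exists x : X, x != 0).
Implicit Types (a c lam : R[i]) (S : {linear X -> X}).

Lemma opnorm_scale (f : X -> X) c : f =1 *:%R c -> opnorm f = (cmod c)%:E.
Proof.
move=> fE; apply/le_anti/andP; split.
  by apply: opnorm_le; rewrite ?cmod_ge0 // => x; rewrite fE rnormZ.
have [x x0] := X_neq0.
have nx : 0 < rnorm x by rewrite lt_neqAle rnorm_ge0 eq_sym rnorm_eq0 x0.
have u1 : rnorm ((rnorm x)^-1%:C *: x) = 1.
  by rewrite rnormZ cmod_real gtr0_norm ?invr_gt0 // mulVf // gt_eqF.
apply: ereal_sup_ubound; exists ((rnorm x)^-1%:C *: x); first by rewrite /= u1.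
by rewrite fE rnormZ u1 mulr1.
Qed.

Lemma scalar_opE a x : scalar_op X a x = a *: x. Proof. by []. Qed.

Lemma iter_scalar_op a n x : iter n (scalar_op X a) x = a ^+ n *: x.
Proof.
elim: n => [|n IH]; first by rewrite expr0 scale1r.
by rewrite /= IH scalerA -exprS.
Qed.

Lemma bounded_scalar_op a : bounded_op (scalar_op X a).
Proof. by rewrite /bounded_op (opnorm_scale _ a) // ltry. Qed.

Lemma power_dev_scalar_op a : power_dev (scalar_op X a) =
  ereal_sup [set (cmod (1 - a ^+ n))%:E | n in [set n | (1 <= n)%N]].
Proof.
congr ereal_sup; apply: eq_imagel => n _; apply: opnorm_scale => x.
by rewrite iter_scalar_op scalerBl scale1r.
Qed.

Lemma resolvent_scalar_op a lam : lam != a ->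
  is_resolvent (scalar_op X a) lam (scalar_op X (lam - a)^-1).
Proof.
move=> la; have d0 : lam - a != 0 by rewrite subr_eq0.
split=> [|x|x]; rewrite ?scalar_opE; first exact: bounded_scalar_op.
  by rewrite -scalerBl scalerA mulVf // scale1r.
by rewrite -scalerBl scalerA mulfV // scale1r.
Qed.

Lemma spectrum_scalar_op a : spectrum (scalar_op X a) `<=` [set a].
Proof.
move=> lam /= nres; apply/eqP/negPn/negP => la; apply: nres.
by exists (scalar_op X (lam - a)^-1); exact: resolvent_scalar_op.
Qed.

Lemma resolvent_norm_scalar_op a lam : lam != a ->
  resolvent_norm (scalar_op X a) lam = (cmod (lam - a))^-1%:E.
Proof.
move=> la; have res := resolvent_scalar_op _ _ la.
rewrite /resolvent_norm -cmodV.
have -> : [set opnorm S | S in is_resolvent (scalar_op X a) lam] =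
    [set (cmod (lam - a)^-1)%:E]; last exact: ereal_inf1.
apply/seteqP; split=> [_ [S [_ S1 S2] <-]|_ ->] /=.
  apply: opnorm_scale => x.
  case: res => _ _ res2; rewrite -[RHS](S1 _); congr (S _); exact/esym/res2.
by exists (scalar_op X (lam - a)^-1) => //; exact: opnorm_scale.
Qed.

Lemma ritt_const_scalar_op a : cmod a <= 1 -> ritt_const (scalar_op X a) =
  ereal_sup [set (cmod (lam - 1) / cmod (lam - a))%:E
            | lam in [set lam | 1 < cmod lam]].
Proof.
move=> a1; congr ereal_sup; apply: eq_imagel => lam /= lam1.
rewrite resolvent_norm_scalar_op -?EFinM //.
by apply: contraTneq lam1 => ->; rewrite -leNgt.
Qed.

Lemma sqr_cmod_conj (z : R[i]) : (cmod z ^+ 2)%:C = z * conjc z.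
Proof. by rewrite rmorphXn /= real_cmod sqr_normc. Qed.

Lemma cmod_conj (z : R[i]) : cmod (conjc z) = cmod z.
Proof. by rewrite /cmod normcJ. Qed.

Lemma conjc_1sub (z : R[i]) : conjc (1 - z) = 1 - conjc z.
Proof. by apply/eqP; case: z => x y; rewrite eq_complex /= !sub0r !eqxx. Qed.

(** The disc automorphism identity: [1 - a w] dominates [a^* - w] in modulus
    exactly when [|a|] and [|w|] lie on the same side of [1]. *)
Lemma moebius_sub a (w : R[i]) :
  cmod (1 - a * w) ^+ 2 - cmod (conjc a - w) ^+ 2 =
    (1 - cmod a ^+ 2) * (1 - cmod w ^+ 2).
Proof. by rewrite !sqr_cmod; case: a w => [x y] [u v] /=; ring. Qed.

(** With [w = (1 - a^* lam) / (lam - a)], of modulus at most [1],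
    [(lam - 1) / (lam - a) = ((1 - a^* ) - (1 - a) w) / (1 - |a|^2)]. *)
Lemma ritt_ratio_le a lam : cmod a < 1 -> 1 < cmod lam ->
  cmod (lam - 1) / cmod (lam - a) <= 2 * cmod (1 - a) / (1 - cmod a ^+ 2).
Proof.
move=> a1 lam1.
have D0 : 0 < 1 - cmod a ^+ 2 by rewrite subr_gt0 expr_lt1 ?cmod_ge0.
have la0 : 0 < cmod (lam - a) by have := ler_cmod_sub lam a; lra.
have conj_la : cmod (1 - conjc a * lam) <= cmod (lam - a).
  rewrite -ler_sqr ?nnegrE ?cmod_ge0 // (cmod_distC lam) -subr_le0.
  have := moebius_sub (conjc a) lam; rewrite conjcK cmod_conj => ->.
  rewrite mulr_ge0_le0 ?(ltW D0) // subr_le0.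
  by rewrite exprn_ege1 // ltW.
rewrite ler_pdivrMr // mulrAC ler_pdivlMr //.
have -> : cmod (lam - 1) * (1 - cmod a ^+ 2) =
    cmod ((1 - conjc a) * (lam - a) - (1 - a) * (1 - conjc a * lam)).
  rewrite -[X in _ * X](gtr0_norm D0) -cmod_real -cmodM; congr cmod.
  rewrite rmorphB /= sqr_cmod_conj rmorph1; ring.
apply: le_trans (cmodD _ _) _; rewrite cmodN !cmodM.
have -> : cmod (1 - conjc a) = cmod (1 - a).
  by rewrite -(cmod_conj (1 - a)) conjc_1sub.
have := ler_wpM2l (cmod_ge0 (1 - a)) conj_la; lra.
Qed.

(** The triangle inequality in [ritt_ratio_le] is an equality when
    [(1 - a) w] points in the direction of [- (1 - a^* )].  Inverting the
    Moebius map at [- s (1 - a^* ) / (1 - a)] for [s < 1] gives an admissible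
    [lam] at which the quotient is [(1 + s) |1 - a| / (1 - |a|^2)], and [s]
    may be taken arbitrarily close to [1]. *)
Lemma ritt_const_scalar_disc a : cmod a < 1 ->
  ritt_const (scalar_op X a) = (2 * cmod (1 - a) / (1 - cmod a ^+ 2))%:E.
Proof.
move=> a1; rewrite ritt_const_scalar_op ?ltW //.
have D0 : 0 < 1 - cmod a ^+ 2 by rewrite subr_gt0 expr_lt1 ?cmod_ge0.
have a_neq1 : 1 - a != 0.
  by rewrite subr_eq0; apply: contraTneq a1 => <-; rewrite cmod1 ltxx.
set c := cmod (1 - a) / (1 - cmod a ^+ 2).
have -> : 2 * cmod (1 - a) / (1 - cmod a ^+ 2) = 2 * c by rewrite mulrA.
have d0 : 0 < cmod (1 - a) by rewrite lt_neqAle cmod_ge0 eq_sym cmod_eq0 a_neq1.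
have c0 : 0 < c by rewrite divr_gt0.
apply/le_anti/andP; split.
  apply: ge_ereal_sup => _ [lam /= lam1 <-]; rewrite lee_fin /c mulrA.
  exact: ritt_ratio_le.
set E := ereal_sup _.
have E_ge s : cmod a < s -> s < 1 -> (((1 + s) * c)%:E <= E)%E.
  move=> as' s1; apply: ereal_sup_ubound.
  have s0 : 0 < s by apply: le_lt_trans as'; exact: cmod_ge0.
  (* w is minus the target value, so that signs disappear below *)
  set w : R[i] := s%:C * ((1 - conjc a) / (1 - a)).
  have ws : cmod w = s.
    rewrite /w !cmodM cmodV -conjc_1sub cmod_conj mulfV ?gt_eqF // mulr1.
    by rewrite cmod_real gtr0_norm.
  (* nonzero because |w| = s > |a| *)
  have den0 : 0 < cmod (conjc a - w).
    have := ler_cmod_sub w (conjc a); rewrite cmod_conj ws cmod_distC; lra.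
  have den_neq0 : conjc a - w != 0 by rewrite -cmod_eq0 gt_eqF.
  have w1 : w * (1 - a) = s%:C * (1 - conjc a).
    by rewrite /w -mulrA divfK.
  set lam := (1 - a * w) / (conjc a - w).
  have lam_a : cmod (lam - a) = (1 - cmod a ^+ 2) / cmod (conjc a - w).
    rewrite -[X in X / _](gtr0_norm D0) -cmod_real -cmodV -cmodM; congr cmod.
    rewrite rmorphB /= sqr_cmod_conj rmorph1 /lam; field.
    by [].
  have lam_1 : cmod (lam - 1) = (1 + s) * cmod (1 - a) / cmod (conjc a - w).
    have s10 : 0 < 1 + s by lra.
    rewrite -(cmod_conj (1 - a)) conjc_1sub -[1 + s in RHS](gtr0_norm s10).
    rewrite -cmod_real.
    rewrite -cmodV -!cmodM; congr cmod.
    have -> : (1 + s)%:C * (1 - conjc a) = 1 - conjc a + w * (1 - a).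
      by rewrite w1 rmorphD rmorph1 mulrDl mul1r.
    by rewrite /lam; field.
  exists lam; last first.
    congr EFin; rewrite lam_a lam_1 /c; field.
    by rewrite !gt_eqF.
  rewrite /= /lam cmodM cmodV ltr_pdivlMr // mul1r.
  rewrite -ltr_sqr ?nnegrE ?cmod_ge0 // -subr_gt0 moebius_sub ws.
  by rewrite mulr_gt0 // subr_gt0 expr_lt1 // ltW.
rewrite leNgt; apply/negP => E_lt.
have [s as_ s1] : exists2 s, cmod a < s & s < 1.
  by exists ((cmod a + 1) / 2); lra.
have E0 := E_ge s as_ s1.
have [e Ee] : exists e, E = e%:E.
  exists (fine E); rewrite fineK // fin_numE; apply/andP; split.
    by apply: contraTneq E0 => ->.
  by apply: contraTneq E_lt => ->; rewrite ltNge leey.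
rewrite Ee lte_fin in E_lt.
pose m := Num.max (cmod a) (e / c - 1).
have m1 : m < 1 by rewrite gt_max a1 ltrBlDr ltr_pdivrMr.
have [am em] : cmod a <= m /\ e / c - 1 <= m.
  by rewrite /m !le_max !lexx orbT.
have : (((1 + (m + 1) / 2) * c)%:E <= E)%E by apply: E_ge; lra.
rewrite Ee lee_fin leNgt -ltr_pdivrMr //; lra.
Qed.

End ScalarOperators.

(** * The complex line as a Banach space *)

Section ComplexComplete.
Context {R : realType}.

Lemma cmod_le_ReIm (z : R[i]) : cmod z <= `|complex.Re z| + `|complex.Im z|.
Proof.
rewrite -ler_sqr ?nnegrE ?cmod_ge0 ?addr_ge0 // sqr_cmod sqrrD.
rewrite !real_normK ?num_real //.
by rewrite lerD2r lerDl mulrn_wge0 // mulr_ge0.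
Qed.

(** Real and imaginary parts are 1-Lipschitz, so they turn a Cauchy filter into
    Cauchy filters on the real line; their limits are the parts of the
    limit. *)
Lemma complex_complete (F : set_system R[i]^o) :
  ProperFilter F -> cauchy F -> cvg F.
Proof.
move=> FF /cauchyP Fc.
have near_ball (e : R) : 0 < e -> exists z : R[i], F [set w | cmod (z - w) < e].
  move=> e0; have [|z Fz] := Fc e%:C; first by rewrite ltcR.
  exists z; move: Fz; rewrite -ball_normE; apply: filterS => w /=.
  by rewrite -real_cmod ltcR.
have part_cvg (g : R[i] -> R) : (forall z w, `|g z - g w| <= cmod (z - w)) ->
    exists l : R, forall e : R, 0 < e -> F [set z | `|l - g z| < e].
  move=> gl; have FgF : ProperFilter (g @ F).
    exact: (@fmap_proper_filter R[i]^o R g F FF).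
  have : cauchy (g @ F).
    apply: cauchy_exP => e e0; have [z Fz] := near_ball e e0.
    exists (g z); change (F (g @^-1` ball (g z) e)).
    move: Fz; apply: filterS => w /= zw.
    by rewrite -ball_normE /=; exact: le_lt_trans (gl _ _) zw.
  move/(cauchy_cvg (g @ F)) => /cvg_ex[l /cvgrPdist_lt gFl]; exists l => e e0.
  exact: gFl.
have [|x Fx] := part_cvg (@complex.Re R).
  move=> z w; rewrite -ler_sqr ?nnegrE ?cmod_ge0 //.
  rewrite real_normK ?num_real // sqr_cmod.
  by case: z w => [a b] [c d] /=; rewrite lerDl sqr_ge0.
have [|y Fy] := part_cvg (@complex.Im R).
  move=> z w; rewrite -ler_sqr ?nnegrE ?cmod_ge0 //.
  rewrite real_normK ?num_real // sqr_cmod.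
  by case: z w => [a b] [c d] /=; rewrite lerDr sqr_ge0.
apply/cvg_ex; exists (x +i* y : R[i]^o); apply/fcvgrPdist_lt => e e0.
have /complex_realP[r er] : e \is Num.real by rewrite gtr0_real.
have r0 : 0 < r / 2 by rewrite divr_gt0 // -ltcR -er.
change (F [set z | `|(x +i* y : R[i]^o) - z| < e]).
apply: (@filterS _ F _ _ _ _ (filterI (Fx _ r0) (Fy _ r0))) => z [] /= zx zy.
rewrite er -[`|_|]real_cmod ltcR; apply: le_lt_trans (cmod_le_ReIm _) _.
by case: z zx zy => a b /=; lra.
Qed.

(** Packed over the existing normed module [R[i]^o], so that facts about
    operators on [R[i]^o] apply to it by conversion. *)
Definition complex_banach : completeNormedModType R[i] :=
  HB.pack R[i]^o (Uniform_isComplete.Build R[i]^o complex_complete).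

End ComplexComplete.

(** * Deviations of powers of extremal scalars *)

Section ScalarExamples.
Context {R : realType}.
Implicit Types (r s : R) (a : R[i]).

(** The hypotheses say that [a] is a root of [X^2 + s X + s].  Since
    [|1 - a^n|^2 = 1 + (s^n - 2 Re (a^n))], the claim is
    [s^n - 2 Re (a^n) <= 2 s], which is an equality for [n = 1].  The
    reduction [a^3 = s^2 - s (1 - s) a] expresses [Re (a^(n+3))] through
    [Re (a^n)], handled by induction, and [Re (a^(n+1))], for which the trivial
    bound [1] is enough because of its factor [s (1 - s)]. *)
Lemma sup_dev_quadratic s a : 0 <= s <= 1 ->
  complex.Re a = - s / 2 -> cmod a ^+ 2 = s ->
  ereal_sup [set (cmod (1 - a ^+ n))%:E | n in [set n | (1 <= n)%N]]
    = (Num.sqrt (1 + 2 * s))%:E.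
Proof.
move=> /andP[s0 s1] Re_a a2.
have a1 : cmod a <= 1 by rewrite -(expr_le1 (n := 2)) ?cmod_ge0 // a2.
have quad : a ^+ 2 = - (s%:C * (1 + a)).
  move: Re_a a2; rewrite sqr_cmod; case: a {a1} => x y /= -> xy.
  apply/eqP; rewrite expr2 eq_complex /=; apply/andP; split; apply/eqP; lra.
have cube : a ^+ 3 = (s ^+ 2)%:C - (s * (1 - s))%:C * a.
  have -> : (s ^+ 2)%:C = s%:C ^+ 2 by rewrite rmorphXn.
  have -> : (s * (1 - s))%:C = s%:C * (1 - s%:C) by rewrite rmorphM rmorphB.
  have -> : a ^+ 3 = - (s%:C * (a + a ^+ 2)).
    by rewrite [LHS]exprS {1}quad; ring.
  by rewrite quad; ring.
have dist n : cmod (1 - a ^+ n) ^+ 2 = 1 + (s ^+ n - 2 * complex.Re (a ^+ n)).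
  by rewrite cmod_distC sqr_cmod_sub1 cmodX exprAC a2; ring.
have Re_le n : complex.Re (a ^+ n) <= 1.
  have : complex.Re (a ^+ n) ^+ 2 <= 1.
    apply: (@le_trans _ _ (cmod (a ^+ n) ^+ 2)).
      by rewrite sqr_cmod lerDl sqr_ge0.
    by rewrite expr_le1 ?cmod_ge0 // cmodX exprn_ile1 ?cmod_ge0.
  by rewrite -real_normK ?num_real // expr_le1 // => /(le_trans (ler_norm _)).
have Re_rec n : complex.Re (a ^+ n.+3) =
    s ^+ 2 * complex.Re (a ^+ n) - s * (1 - s) * complex.Re (a ^+ n.+1).
  have -> : a ^+ n.+3 = (s ^+ 2)%:C * a ^+ n - (s * (1 - s))%:C * a ^+ n.+1.
    rewrite -addn3 exprD cube (exprSr a n); ring.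
  by case: (a ^+ n) (a ^+ n.+1) => [x y] [u v] /=; ring.
have bound n : s ^+ n - 2 * complex.Re (a ^+ n) <= 2 * s.
  suff : [/\ s ^+ n - 2 * complex.Re (a ^+ n) <= 2 * s,
     s ^+ n.+1 - 2 * complex.Re (a ^+ n.+1) <= 2 * s
   & s ^+ n.+2 - 2 * complex.Re (a ^+ n.+2) <= 2 * s] by case.
  elim: n => [|n [h0 h1 h2]]; split=> //.
  - rewrite !expr0 /=; lra.
  - rewrite !expr1 Re_a; lra.
  - rewrite quad.
    by case: a Re_a {a1 quad cube dist Re_le Re_rec a2} => x y /= ->; lra.
  - rewrite Re_rec -(addn3 n) exprD.
    have sn : 0 <= s ^+ n by rewrite exprn_ge0.
    have e1 : 0 <= s * (1 - s) * (1 - complex.Re (a ^+ n.+1)).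
      by rewrite !mulr_ge0 ?subr_ge0.
    have e2 := ler_wpM2l (sqr_ge0 s) h0.
    have e3 : 0 <= s ^+ 2 * (1 - s) by rewrite mulr_ge0 ?sqr_ge0 ?subr_ge0.
    have e4 := mulr_ge0 e3 sn.
    lra.
apply/le_anti/andP; split.
  apply: ge_ereal_sup => _ [n _ <-]; rewrite lee_fin.
  rewrite -ler_sqr ?nnegrE ?cmod_ge0 ?sqrtr_ge0 // sqr_sqrtr; last lra.
  by rewrite dist lerD2l.
apply: ereal_sup_ubound; exists 1%N => //; congr EFin.
apply/eqP; rewrite -(@eqrXn2 _ 2) ?cmod_ge0 ?sqrtr_ge0 //.
by rewrite dist sqr_sqrtr ?expr1 ?Re_a; [apply/eqP; field|lra].
Qed.

Definition extremal r : R[i] := r%:C * cis (acos (- r / 2)).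

Lemma extremalE r : 0 <= r -> r < 1 ->
  [/\ complex.Re (extremal r) = - r ^+ 2 / 2,
      cmod (extremal r) ^+ 2 = r ^+ 2 & cmod (extremal r) < 1].
Proof.
move=> r0 r1; have ca : cmod (extremal r) = r.
  by rewrite cmodM cmod_cis mulr1 cmod_real ger0_norm.
rewrite ca; split=> //=.
have [|_ ->] := @acos_def R (- r / 2); first lra.
by rewrite mul0r subr0; field.
Qed.

End ScalarExamples.

(** * Sharpness *)

Section Sharpness.
Context {R : realType}.
Implicit Types (r q B : R).

Lemma complex_neq0 : exists x : R[i]^o, x != 0.
Proof. by exists 1; exact: oner_neq0. Qed.

Lemma extremal_ritt r : 0 <= r -> r < 1 ->
  let T := scalar_op R[i]^o (extremal r) in
  [/\ spectrum T `<=` open_unit_disc, ritt T,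
      power_dev T = (Num.sqrt (1 + 2 * r ^+ 2))%:E
    & ritt_const T = (2 * Num.sqrt (1 + 2 * r ^+ 2) / (1 - r ^+ 2))%:E].
Proof.
move=> r0 r1 T; have [Re_a a2 a1] := extremalE r r0 r1.
have r21 : r ^+ 2 <= 1 by rewrite exprn_ile1 // ltW.
have spec : spectrum T `<=` open_unit_disc.
  by move=> lam /(spectrum_scalar_op complex_neq0) ->.
have RT : ritt_const T = (2 * Num.sqrt (1 + 2 * r ^+ 2) / (1 - r ^+ 2))%:E.
  rewrite /T (ritt_const_scalar_disc complex_neq0) // a2.
  have -> // : cmod (1 - extremal r) = Num.sqrt (1 + 2 * r ^+ 2).
  have q0 : 0 <= 1 + 2 * r ^+ 2 by rewrite addr_ge0 // mulr_ge0 // sqr_ge0.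
  apply/eqP; rewrite -(@eqrXn2 _ 2) ?cmod_ge0 ?sqrtr_ge0 // cmod_distC.
  by rewrite sqr_cmod_sub1 a2 Re_a sqr_sqrtr //; apply/eqP; field.
split=> //.
  split; first exact: (bounded_scalar_op complex_neq0).
    by move=> lam /spec /ltW.
  by rewrite RT ltry.
rewrite /T (power_dev_scalar_op complex_neq0).
by apply: sup_dev_quadratic => //; rewrite sqr_ge0.
Qed.

Lemma sqrt_dev_lt r : 0 <= r -> r < 1 ->
  1 <= Num.sqrt (1 + 2 * r ^+ 2) < Num.sqrt (3 : R).
Proof.
move=> r0 r1; have r2 : 0 <= r ^+ 2 < 1 by rewrite sqr_ge0 expr_lt1.
rewrite ltr_sqrt -?[X in X <= _]sqrtr1 ?ler_sqrt; lra.
Qed.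

(** The cube root of unity is the case [s = 1] of [sup_dev_quadratic].  Along
    the ray [lam = t w] with [t > 1] the resolvent norm is [1 / (t - 1)] while
    [|lam - 1| >= 1], so the Ritt constant is infinite. *)
Lemma rotation_not_ritt (X : normedModType R[i]) : (exists x : X, x != 0) ->
  let T := scalar_op X (cis (2 * pi / 3)) in
  power_dev T = (Num.sqrt 3)%:E /\ ~ ritt T.
Proof.
move=> X0 T; set w : R[i] := cis (2 * pi / 3) in T *.
have Re_w : complex.Re w = - (1 / 2) by exact: cos_two_thirds_pi.
have w1 : cmod w = 1 by exact: cmod_cis.
split.
  rewrite /T (power_dev_scalar_op X0).
  rewrite (@sup_dev_quadratic R 1) ?w1 ?expr1n ?lexx ?ler01 //.
    by congr ((Num.sqrt _)%:E); lra.
  by rewrite Re_w; lra.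
case=> _ _; rewrite /T (ritt_const_scalar_op X0) ?w1 //.
set E := ereal_sup _ => E_lt.
have E_ge B : 0 < B -> (B%:E <= E)%E.
  move=> B0; set t := 1 + B^-1.
  have t1 : 1 < t by rewrite ltrDl invr_gt0.
  have lam1 : cmod (t%:C * w) = t.
    by rewrite cmodM w1 mulr1 cmod_real gtr0_norm // (lt_trans ltr01).
  have Re_lam : complex.Re (t%:C * w) = - (t / 2).
    by case: (w) Re_w => x y /= ->; rewrite mul0r subr0; field.
  set c := cmod (t%:C * w - 1) / cmod (t%:C * w - w).
  apply: (@le_trans _ _ c%:E); last first.
    by apply: ereal_sup_ubound; exists (t%:C * w) => //=; rewrite lam1.
  have -> : c = cmod (t%:C * w - 1) / B^-1.
    congr (_ / _).
    have -> : t%:C * w - w = (B^-1)%:C * w.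
      by rewrite -{2}[w]mul1r -mulrBl -rmorphB /= /t addrC addKr.
    by rewrite cmodM w1 mulr1 cmod_real gtr0_norm // invr_gt0.
  rewrite invrK lee_fin ler_peMl ?(ltW B0) //.
  rewrite -(expr_ge1 (n := 2)) ?cmod_ge0 // sqr_cmod_sub1 Re_lam lam1.
  by have := sqr_ge0 t; lra.
suff : E = +oo%E by move=> EE; rewrite EE in E_lt.
exact/eqyP.
Qed.

(** The numerator is at least [2], so it is enough to make
    [1 - r^2 = 1 / (|B| + 1)]. *)
Lemma extremal_ritt_const_gt B : exists2 r, 0 <= r < 1 &
  B < 2 * Num.sqrt (1 + 2 * r ^+ 2) / (1 - r ^+ 2).
Proof.
have B1 : 0 < `|B| + 1 by rewrite ltr_wpDl.
have i0 : 0 < (`|B| + 1)^-1 by rewrite invr_gt0.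
have i1 : (`|B| + 1)^-1 <= 1 by rewrite invf_le1 // lerDr.
set r := Num.sqrt (1 - (`|B| + 1)^-1).
have r2 : r ^+ 2 = 1 - (`|B| + 1)^-1 by rewrite sqr_sqrtr // subr_ge0.
have r0 : 0 <= r by rewrite sqrtr_ge0.
have r1 : r < 1 by rewrite -(expr_lt1 (n := 2)) // r2; lra.
exists r; first by rewrite r0.
have /andP[q1 _] := sqrt_dev_lt r r0 r1.
rewrite {2}r2 subKr invrK.
have := ler_wpM2r (ltW B1) q1.
have := ler_norm B; lra.
Qed.

End Sharpness.

Theorem theorem4p6 (R : realType) :
  let sqrt3 : R := Num.sqrt 3 in
  [/\
    forall (q : R) (X : completeNormedModType R[i]) (T : {linear X -> X}),
      1 <= q -> q < sqrt3 ->
      bounded_op T -> (power_dev T <= q%:E)%E ->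
      [/\ ritt T,
          (ritt_const T <=
             (2 * sqrt3 / (sqrt3 - q))%:E * power_bound T)%E
        & ((2 * sqrt3 / (sqrt3 - q))%:E * power_bound T <=
             ((6 + 2 * sqrt3) / (sqrt3 - q))%:E)%E],
    forall r : R, 0 <= r -> r < 1 ->
      let a : R[i] := r%:C * cis (acos (- r / 2)) in
      let qr : R := Num.sqrt (1 + 2 * r ^+ 2) in
      [/\ ereal_sup [set (cmod (1 - a ^+ n))%:E | n in [set n | (1 <= n)%N]]
            = qr%:E,
          ritt_const (scalar_op R[i]^o a)
            = (2 * qr / (1 - r ^+ 2))%:E
        & 2 * qr / (1 - r ^+ 2) = 4 * qr / (3 - qr ^+ 2)],
    forall q : R, 1 <= q -> q < sqrt3 ->
      ((4 * q / (3 - q ^+ 2))%:E <= Phi_star q)%E /\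
      (Phi_star q <= ((6 + 2 * sqrt3) / (sqrt3 - q))%:E)%E,
    forall X : completeNormedModType R[i], (exists x : X, x != 0) ->
      let T := scalar_op X (cis (2 * pi / 3)) in
      power_dev T = sqrt3%:E /\ ~ ritt T
  & forall q : R, sqrt3 <= q -> q < 2 ->
      ereal_sup [set c : \bar R |
        exists (Y : completeNormedModType R[i]) (T : {linear Y -> Y}),
          [/\ ritt T, (power_dev T <= q%:E)%E & c = ritt_const T]] = +oo%E /\
      forall B : R, exists a : R[i],
        let T := scalar_op R[i]^o a in
        [/\ spectrum T `<=` open_unit_disc, ritt T,
            (power_dev T <= q%:E)%E & (B%:E < ritt_const T)%E]].
Proof.
move=> sqrt3.
have formula r : 0 <= r -> r < 1 -> let qr := Num.sqrt (1 + 2 * r ^+ 2) in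
    2 * qr / (1 - r ^+ 2) = 4 * qr / (3 - qr ^+ 2) :> R.
  move=> r0 r1 qr; have r21 : r ^+ 2 < 1 by rewrite expr_lt1.
  have r20 := sqr_ge0 r.
  have -> : 3 - qr ^+ 2 = 2 * (1 - r ^+ 2) by rewrite sqr_sqrtr; lra.
  by field; rewrite subr_eq0 gt_eqF.
split.
- by move=> q X T; exact: ritt_of_power_dev.
- move=> r r0 r1 a qr.
  have [_ _ dev rc] := extremal_ritt r r0 r1.
  rewrite (power_dev_scalar_op complex_neq0) in dev.
  split=> //; exact: formula.
- move=> q q1 q3; split; last first.
    apply: ge_ereal_sup => _ [Y [S [bS dS ->]]].
    have [_ h1 h2] := ritt_of_power_dev _ _ q1 q3 bS dS.
    exact: le_trans h1 h2.
  have q0 : 0 <= q by rewrite (le_trans ler01).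
  have q23 : q ^+ 2 < 3.
    by rewrite -[ltRHS](@sqr_sqrtr R) // ltr_sqr // nnegrE sqrtr_ge0.
  have q21 : 1 <= q ^+ 2 by rewrite exprn_ege1.
  (* the solution of sqrt (1 + 2 r ^ 2) = q *)
  set r := Num.sqrt ((q ^+ 2 - 1) / 2).
  have r2 : r ^+ 2 = (q ^+ 2 - 1) / 2 by rewrite sqr_sqrtr //; lra.
  have r0 : 0 <= r by rewrite sqrtr_ge0.
  have r1 : r < 1 by rewrite -(expr_lt1 (n := 2)) // r2; lra.
  have qr : Num.sqrt (1 + 2 * r ^+ 2) = q.
    have -> : 1 + 2 * r ^+ 2 = q ^+ 2 by rewrite r2; field.
    by rewrite sqrtr_sqr ger0_norm.
  have [_ [bT _ _] dev rc] := extremal_ritt r r0 r1.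
  have := formula r r0 r1; rewrite /= qr => <-.
  rewrite qr in dev rc; rewrite -rc.
  apply: ereal_sup_ubound; exists (complex_banach : completeNormedModType R[i]).
  exists (scalar_op complex_banach (extremal r)); split=> //.
  by rewrite [power_dev _]dev.
- by move=> X; exact: rotation_not_ritt.
move=> q q3 q2.
have ex B : exists r, let T := scalar_op R[i]^o (extremal r) in
  [/\ spectrum T `<=` open_unit_disc, ritt T,
      (power_dev T <= q%:E)%E & (B%:E < ritt_const T)%E].
  have [r /andP[r0 r1] Br] := extremal_ritt_const_gt B.
  have [spec rT dev rc] := extremal_ritt r r0 r1.
  exists r => T; split=> //; last by rewrite rc lte_fin.
  have /andP[_ qr3] := sqrt_dev_lt r r0 r1.
  by rewrite dev lee_fin (le_trans (ltW qr3)).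
split; last by move=> B; have [r] := ex B; exists (extremal r).
apply/eqyP => B B0; have [r [_ rT dev Br]] := ex B.
apply: le_trans (ltW Br) _; apply: ereal_sup_ubound.
by exists complex_banach, (scalar_op complex_banach (extremal r)).
Qed.
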